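(* Let $U$ be a two-qubit unitary with KAK parameters $(u_0,u_1,u_2,u_3)$. For $n\in\mathbb{N}$ let $U^{\otimes n}$ act on $n$ disjoint pairs of qubits, with $A$ (respectively $B$) the tensor product of the first (respectively second) qubits of all pairs. Then, for $S$ either $\mathrm{LO}$ or $\mathrm{LOCC}$ (with respect to the bipartition $A,B$), the regularized $\gamma$-factor satisfies $$\gamma_R(U):=\lim_{n\to\infty}\big(\gamma_S(U^{\otimes n})\big)^{1/n}=\lim_{n\to\infty}\Big(2\Big(\sum_{i=0}^3|u_i|\Big)^{2n}-1\Big)^{1/n}=\Big(\sum_{i=0}^3|u_i|\Big)^2=1+\sum_{i\neq j}|u_i|\,|u_j| ,$$ where the last sum is over all ordered pairs $(i,j)\in\{0,1,2,3\}^2$ with $i\ne j$.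
   Context: All Hilbert spaces are finite-dimensional. $\mathrm{CPTP}(X)$ is the set of completely positive trace-preserving maps on system $X$. KAK parameters: every two-qubit unitary $U$ can be written as $U=(V_1\otimes V_2)\big(\sum_{k=0}^3 u_k\,\sigma_k\otimes\sigma_k\big)(V_3\otimes V_4)$ with single-qubit unitaries $V_1,\dots,V_4$, $\sigma_0=\mathds{1}$, $\sigma_1,\sigma_2,\sigma_3$ the Pauli matrices $X,Y,Z$, and $u_k\in\mathbb{C}$ with $\sum_k|u_k|^2=1$. The $u_k$ are called the KAK parameters of $U$. Local operations: $\mathcal{N}(X)=\{\mathcal{A}^+-\mathcal{A}^-:\ \mathcal{A}^\pm \text{ completely positive},\ \mathcal{A}^++\mathcal{A}^-\in\mathrm{CPTP}(X)\}$ and $\mathrm{LO}(A,B)=\{\mathcal{F}_A\otimes\mathcal{F}_B:\ \mathcal{F}_A\in\mathcal{N}(A),\ \mathcal{F}_B\in\mathcal{N}(B)\}$. LOCC: an instrument is a finite family $(\mathcal{E}_i)$ of completely positive maps whose sum is trace preserving. A one-way local instrument from $A$ has the form $(\mathcal{E}_i\otimes\mathcal{T}_i)_i$ with $(\mathcal{E}_i)$ an instrument on $A$ and each $\mathcal{T}_i$ CPTP on $B$ (analogously from $B$). An LOCC instrument is obtained by finitely many rounds, in each of which a one-way local instrument (from $A$ or from $B$, possibly changing the local finite dimensions) is applied that may depend on all previous outcomes, followed by coarse-graining (summing) of outcomes. $\mathrm{LOCC}(A,B)$ is the set of maps $\sum_i s_i\mathcal{E}_i$ on $AB$ with $(\mathcal{E}_i)$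 an LOCC instrument and $s_i\in\{+1,-1\}$. $\gamma$-factor: for a linear map $\mathcal{E}$ on $AB$ and $S\in\{\mathrm{LO}(A,B),\mathrm{LOCC}(A,B)\}$, $\gamma_S(\mathcal{E})=\min\{\sum_{i=1}^m|a_i| : \mathcal{E}=\sum_{i=1}^m a_i\mathcal{F}_i,\ m\ge1,\ \mathcal{F}_i\in S,\ a_i\in\mathbb{R}\}$. For a unitary $U$, $\gamma_S(U)$ means $\gamma_S$ of the channel $\rho\mapsto U\rho U^\dagger$. *)

(* Defs.v *)
From HB Require Import structures.
From mathcomp Require Import all_boot all_order all_algebra.
From mathcomp Require Import spectral complex mxtens.
From mathcomp Require Import boolp classical_sets reals topology normedtype exp.

Set Implicit Arguments.
Unset Strict Implicit.
Unset Printing Implicit Defensive.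

Import Order.TTheory GRing.Theory Num.Theory.
Import numFieldNormedType.Exports.

Local Open Scope classical_set_scope.
Local Open Scope complex_scope.
Local Open Scope ring_scope.

(* The system C^a (x) C^b has dimension [a * b]; its basis vector e_i (x) e_k
   has the index [mxtens_index (i, k)], as in the Kronecker product [A *t B]. *)
Notation superop R n m := 'Hom('M[R[i]]_n, 'M[R[i]]_m).
Notation adjmx A := (map_mx Num.conj A^T).

Section Superoperators.
Variable R : realType.
Local Notation C := R[i].

(* The order of [C] makes [0 <= z] mean that z is real and nonnegative. *)
Definition psd n (A : 'M[C]_n) : Prop :=
  forall v : 'cV[C]_n, 0 <= (adjmx v *m A *m v) 0 0.

Definition tens_fun n m p q (F : superop R n m) (G : superop R p q)
    (X : 'M[C]_(n * p)) : 'M[C]_(m * q) :=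
  \sum_(i < n) \sum_(j < n) \sum_(k < p) \sum_(l < p)
    X (mxtens_index (i, k)) (mxtens_index (j, l)) *:
      (F (delta_mx i j) *t G (delta_mx k l)).

Fact tens_fun_is_linear n m p q F G : linear (@tens_fun n m p q F G).
Proof.
move=> c X Y; rewrite /tens_fun scaler_sumr -big_split /=; apply: eq_bigr => i _.
rewrite scaler_sumr -big_split /=; apply: eq_bigr => j _.
rewrite scaler_sumr -big_split /=; apply: eq_bigr => k _.
rewrite scaler_sumr -big_split /=; apply: eq_bigr => l _.
by rewrite !mxE scalerDl scalerA.
Qed.
HB.instance Definition _ n m p q (F : superop R n m) (G : superop R p q) :=
  GRing.isLinear.Build C 'M[C]_(n * p) 'M[C]_(m * q) _ _
    (tens_fun_is_linear F G).

Definition tens_op n m p q (F : superop R n m) (G : superop R p q) :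
    superop R (n * p) (m * q) :=
  linfun (tens_fun F G).

Lemma tens_opE n m p q (F : superop R n m) (G : superop R p q)
    (X : 'M[C]_n) (Y : 'M[C]_p) :
  tens_op F G (X *t Y) = F X *t G Y.
Proof.
rewrite /tens_op lfunE /= /tens_fun.
rewrite [in RHS](matrix_sum_delta X) [in RHS](matrix_sum_delta Y).
rewrite !linear_sum /=.
apply/matrixP => r s; case: (mxtens_indexP r) => r1 r2.
case: (mxtens_indexP s) => s1 s2.
rewrite tensmxE !summxE mulr_suml; apply: eq_bigr => i _.
rewrite linear_sum !summxE mulr_suml; apply: eq_bigr => j _.
rewrite mulr_sumr summxE; apply: eq_bigr => k _.
rewrite linear_sum !summxE mulr_sumr; apply: eq_bigr => l _.
by rewrite !linearZ /= !mxE !mxtens_indexK /= mulrACA.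
Qed.

Definition completely_positive n m (F : superop R n m) : Prop :=
  forall k (X : 'M[C]_(k * n)), psd X -> psd (tens_op (\1%VF : superop R k k) F X).

Definition trace_preserving n m (F : superop R n m) : Prop :=
  forall X : 'M[C]_n, \tr (F X) = \tr X.

Definition CPTP n m (F : superop R n m) : Prop :=
  completely_positive F /\ trace_preserving F.

Definition unitary_channel n (U : 'M[C]_n) : superop R n n :=
  linfun (mulmxr (adjmx U) \o mulmx U).

Lemma unitary_channelE n (U X : 'M[C]_n) :
  unitary_channel U X = U *m X *m adjmx U.
Proof. by rewrite /unitary_channel lfunE. Qed.

(* The set written N(X) for a system X of dimension n. *)
Definition signed_local n : set (superop R n n) :=
  [set F | exists Fp Fm : superop R n n,
    [/\ completely_positive Fp, completely_positive Fm,
        CPTP (Fp + Fm) & F = Fp - Fm]].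

Definition LO a b : set (superop R (a * b) (a * b)) :=
  [set F | exists (FA : superop R a a) (FB : superop R b b),
    [/\ signed_local FA, signed_local FB & F = tens_op FA FB]].

Definition instrument (I : finType) n m (E : I -> superop R n m) : Prop :=
  (forall i, completely_positive (E i)) /\ trace_preserving (\sum_i E i).

Definition one_way_fromA (I : finType) a b a' b'
    (E : I -> superop R (a * b) (a' * b')) : Prop :=
  exists (EA : I -> superop R a a') (TB : I -> superop R b b'),
    [/\ instrument EA, forall i, CPTP (TB i)
      & forall i, E i = tens_op (EA i) (TB i)].

Definition one_way_fromB (I : finType) a b a' b'
    (E : I -> superop R (a * b) (a' * b')) : Prop :=
  exists (TA : I -> superop R a a') (EB : I -> superop R b b'),
    [/\ instrument EB, forall i, CPTP (TA i)
      & forall i, E i = tens_op (TA i) (EB i)].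

(* A protocol is a finite tree. Its root is the first round, and the subtree
   below outcome i is the rest of the protocol, which thus may depend on i.
   Outcomes of the whole protocol are the branches, hence the dependent pairs. *)
Inductive LOCC_rounds (c d : nat) :
    forall (a b : nat) (I : finType), (I -> superop R (a * b) (c * d)) -> Prop :=
| LOCC_rounds0 : @LOCC_rounds c d c d unit (fun=> \1%VF)
| LOCC_roundsS a b a' b' (I : finType) (E : I -> superop R (a * b) (a' * b'))
    (J : I -> finType)
    (F : forall i : I, J i -> superop R (a' * b') (c * d)) :
    one_way_fromA E \/ one_way_fromB E ->
    (forall i, @LOCC_rounds c d a' b' (J i) (@F i)) ->
    @LOCC_rounds c d a b {i : I & J i}
      (fun p => (F (tag p) (tagged p) \o E (tag p))%VF).

Definition LOCC_instrument a b c d (I : finType)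
    (E : I -> superop R (a * b) (c * d)) : Prop :=
  exists (J : finType) (F : J -> superop R (a * b) (c * d)) (f : J -> I),
    @LOCC_rounds c d a b J F /\ forall i, E i = \sum_(j | f j == i) F j.

Definition LOCC a b : set (superop R (a * b) (a * b)) :=
  [set F | exists (I : finType) (E : I -> superop R (a * b) (a * b))
      (s : I -> bool),
    @LOCC_instrument a b a b I E /\ F = \sum_i (-1) ^+ s i *: E i].

Definition decomposition_costs n (S : set (superop R n n)) (E : superop R n n) :
    set R :=
  [set c | exists m (x : 'I_m -> R) (F : 'I_m -> superop R n n),
    [/\ (0 < m)%N, forall i, S (F i), E = \sum_i (x i)%:C *: F i
      & c = \sum_i `|x i|]].

(* [is_gamma S E g] says that the minimum defining gamma_S(E) exists and is g. *)
Definition is_gamma n (S : set (superop R n n)) (E : superop R n n) (g : R) :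
    Prop :=
  decomposition_costs S E g /\ lbound (decomposition_costs S E) g.

(* The tensor product of operators on A1 B1 and A2 B2, as an operator on
   (A1 A2) (B1 B2). *)
Definition bitens a1 b1 a2 b2 (X : 'M[C]_(a1 * b1)) (Y : 'M[C]_(a2 * b2)) :
    'M[C]_((a1 * a2) * (b1 * b2)) :=
  \matrix_(r, c)
    let ra := mxtens_unindex (mxtens_unindex r).1 in
    let rb := mxtens_unindex (mxtens_unindex r).2 in
    let ca := mxtens_unindex (mxtens_unindex c).1 in
    let cb := mxtens_unindex (mxtens_unindex c).2 in
    X (mxtens_index (ra.1, rb.1)) (mxtens_index (ca.1, cb.1)) *
    Y (mxtens_index (ra.2, rb.2)) (mxtens_index (ca.2, cb.2)).

Lemma bitens_tens a1 b1 a2 b2 (X1 : 'M[C]_a1) (Y1 : 'M[C]_b1)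
    (X2 : 'M[C]_a2) (Y2 : 'M[C]_b2) :
  bitens (X1 *t Y1) (X2 *t Y2) = (X1 *t X2) *t (Y1 *t Y2).
Proof.
apply/matrixP => r c; rewrite mxE; cbv zeta.
case: (mxtens_indexP r) => ra rb; case: (mxtens_indexP c) => ca cb.
rewrite tensmxE !mxtens_indexK; cbv [fst snd].
case: (mxtens_indexP ra) => r1 r2; case: (mxtens_indexP rb) => r3 r4.
case: (mxtens_indexP ca) => c1 c2; case: (mxtens_indexP cb) => c3 c4.
by rewrite !mxtens_indexK; cbv [fst snd]; rewrite !tensmxE mulrACA.
Qed.

(* [qdim n] is 2 ^ n, in a form where [qdim n.+1] unfolds to [2 * qdim n]. *)
Fixpoint qdim (n : nat) : nat := if n is n'.+1 then (2 * qdim n')%N else 1%N.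

Lemma qdimE n : qdim n = (2 ^ n)%N.
Proof. by elim: n => //= n ->; rewrite expnS. Qed.

Fixpoint tens_power (U : 'M[C]_(2 * 2)) (n : nat) : 'M[C]_(qdim n * qdim n) :=
  if n is n'.+1 then bitens U (tens_power U n') else 1%:M.

Definition mx22 (x y z t : C) : 'M[C]_2 :=
  \matrix_(i, j) if i == 0 then (if j == 0 then x else y)
                 else (if j == 0 then z else t).

Definition pauli (k : 'I_4) : 'M[C]_2 :=
  nth 0 [:: 1%:M; mx22 0 1 1 0; mx22 0 (- 'i%C) 'i%C 0; mx22 1 0 0 (-1)] k.

Definition cmod (z : C) : R := ComplexField.Normc.normc z.

Lemma cmodE (z : C) : (cmod z)%:C = `|z|.
Proof. by []. Qed.

Definition KAK_parameters (U : 'M[C]_(2 * 2)) (u : 'I_4 -> C) : Prop :=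
  \sum_k cmod (u k) ^+ 2 = 1 /\
  exists V1 V2 V3 V4 : 'M[C]_2,
    [/\ V1 \is unitarymx, V2 \is unitarymx, V3 \is unitarymx, V4 \is unitarymx
      & U = (V1 *t V2) *m (\sum_k u k *: (pauli k *t pauli k)) *m (V3 *t V4)].

End Superoperators.

Arguments LO {R} a b.
Arguments LOCC {R} a b.

(* Main.v *)
Require Import Defs.
From HB Require Import structures.
From mathcomp Require Import all_boot all_order all_algebra.
From mathcomp Require Import spectral complex mxtens ring.
From mathcomp Require Import boolp classical_sets reals topology normedtype sequences exp.

Set Implicit Arguments.
Unset Strict Implicit.
Unset Printing Implicit Defensive.

Import Order.TTheory GRing.Theory Num.Theory.
Import numFieldNormedType.Exports.

Local Open Scope classical_set_scope.
Local Open Scope complex_scope.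
Local Open Scope ring_scope.

(* The value at n is exactly 2 s^(2n) - 1, where s = sum_k |u_k|. Absorbing the phases
   of the u_k in local unitaries, the n-th tensor power is sum_k c_k L_k (x) M_k with
   c_k >= 0, sum_k c_k^2 = 1, sum_k c_k = s^n, and L_k, M_k unitary and orthogonal for the
   trace form.

   Upper bound, in LO: the diagonal terms of the channel cost sum_k c_k^2 = 1. Polarizing the
   off-diagonal terms X |-> L_k X L_l^* and X |-> M_k X M_l^* into Hermitian and anti-Hermitian
   parts gives two elements of LO for each pair k, l, with coefficients +- c_k c_l.

   Lower bound, for every signed sum of products of completely positive maps with trace
   preserving total, hence for LOCC: the functional 2 <Phi| J |Phi> - tr J on Choi matrices,
   with Phi = sum_k |L_k> |M_k>, has modulus at most 1 on these maps, because
   0 <= sum_kl P_kl Q_kl <= tr P tr Q for positive semidefinite P, Q; it takes the value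
   2 (sum_k c_k)^2 - 1 on the channel. *)

(** * Kronecker products of matrices *)

Section Tensor.
Variable C : comPzRingType.

Lemma tensmx11 m n : (1%:M : 'M[C]_m) *t (1%:M : 'M[C]_n) = 1%:M.
Proof.
apply/matrixP => r s; case: (mxtens_indexP r) => i k.
case: (mxtens_indexP s) => j l; rewrite tensmxE !mxE.
by rewrite (can_eq (@mxtens_indexK m n)) xpair_eqE -mulnb natrM.
Qed.

Lemma tensmxDl m n p q (A A' : 'M[C]_(m, n)) (B : 'M[C]_(p, q)) :
  (A + A') *t B = A *t B + A' *t B.
Proof. by apply/matrixP => i j; rewrite !mxE mulrDl. Qed.

Lemma tensmxDr m n p q (A : 'M[C]_(m, n)) (B B' : 'M[C]_(p, q)) :
  A *t (B + B') = A *t B + A *t B'.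
Proof. by apply/matrixP => i j; rewrite !mxE mulrDr. Qed.

Lemma tensmxNl m n p q (A : 'M[C]_(m, n)) (B : 'M[C]_(p, q)) : (- A) *t B = - (A *t B).
Proof. by apply/matrixP => i j; rewrite !mxE mulNr. Qed.

Lemma tensmxNr m n p q (A : 'M[C]_(m, n)) (B : 'M[C]_(p, q)) : A *t (- B) = - (A *t B).
Proof. by apply/matrixP => i j; rewrite !mxE mulrN. Qed.

Lemma tensmxZl m n p q a (A : 'M[C]_(m, n)) (B : 'M[C]_(p, q)) :
  (a *: A) *t B = a *: (A *t B).
Proof. by apply/matrixP => i j; rewrite !mxE mulrA. Qed.

Lemma tensmxZr m n p q a (A : 'M[C]_(m, n)) (B : 'M[C]_(p, q)) :
  A *t (a *: B) = a *: (A *t B).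
Proof. by apply/matrixP => i j; rewrite !mxE mulrCA. Qed.

Lemma delta_mx_tens m n p q (i : 'I_m) (j : 'I_n) (k : 'I_p) (l : 'I_q) :
  delta_mx (mxtens_index (i, k)) (mxtens_index (j, l)) =
  (delta_mx i j : 'M[C]_(m, n)) *t delta_mx k l.
Proof.
apply/matrixP => r s; case: (mxtens_indexP r) => r1 r2.
case: (mxtens_indexP s) => s1 s2; rewrite tensmxE !mxE.
rewrite !(can_eq (@mxtens_indexK _ _)) !xpair_eqE -natrM mulnb.
by congr (nat_of_bool _)%:R; rewrite andbACA.
Qed.

Lemma big_mxtens_index (V : nmodType) m n (F : 'I_(m * n) -> V) :
  \sum_r F r = \sum_i \sum_k F (mxtens_index (i, k)).
Proof.
rewrite pair_big /= (reindex (@mxtens_index m n)) /=.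
  by apply: eq_bigr => -[].
by exists (@mxtens_unindex m n) => ? _; rewrite (mxtens_indexK, mxtens_unindexK).
Qed.

Lemma mxtrace_tens m n (A : 'M[C]_m) (B : 'M[C]_n) : \tr (A *t B) = \tr A * \tr B.
Proof.
rewrite /mxtrace big_mxtens_index mulr_suml; apply: eq_bigr => i _.
by rewrite mulr_sumr; apply: eq_bigr => k _; rewrite tensmxE.
Qed.

End Tensor.

(** * Adjoints and unitary matrices *)

Section Adjoint.
Variable C : numClosedFieldType.

Lemma adjmxK m n (A : 'M[C]_(m, n)) : adjmx (adjmx A) = A.
Proof. by apply/matrixP => i j; rewrite !mxE conjCK. Qed.

Lemma adjmx_mul m n p (A : 'M[C]_(m, n)) (B : 'M[C]_(n, p)) :
  adjmx (A *m B) = adjmx B *m adjmx A.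
Proof. by rewrite trmx_mul map_mxM. Qed.

Lemma adjmxD m n (A B : 'M[C]_(m, n)) : adjmx (A + B) = adjmx A + adjmx B.
Proof. by rewrite linearD map_mxD. Qed.

Lemma adjmxB m n (A B : 'M[C]_(m, n)) : adjmx (A - B) = adjmx A - adjmx B.
Proof. by rewrite linearB map_mxB. Qed.

Lemma adjmxZ m n a (A : 'M[C]_(m, n)) : adjmx (a *: A) = Num.conj a *: adjmx A.
Proof. by rewrite linearZ map_mxZ. Qed.

Lemma adjmx1 n : adjmx 1%:M = 1%:M :> 'M[C]_n.
Proof. by rewrite trmx1 map_mx1. Qed.

Lemma adjmx_delta m n (i : 'I_m) (j : 'I_n) : adjmx (delta_mx i j) = delta_mx j i :> 'M[C]_(n, m).
Proof. by apply/matrixP => x y; rewrite !mxE rmorph_nat andbC. Qed.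

Lemma adjmx_sum I (r : seq I) (P : pred I) m n (F : I -> 'M[C]_(m, n)) :
  adjmx (\sum_(i <- r | P i) F i) = \sum_(i <- r | P i) adjmx (F i).
Proof. by rewrite !raddf_sum. Qed.

Lemma adjmx_tens m n p q (A : 'M[C]_(m, n)) (B : 'M[C]_(p, q)) :
  adjmx (A *t B) = adjmx A *t adjmx B.
Proof. by rewrite trmx_tens map_mxT. Qed.

Lemma mul_adjmx n (A : 'M[C]_n) : A \is unitarymx -> A *m adjmx A = 1%:M.
Proof. by move/unitarymxP. Qed.

Lemma mul_adjmxV n (A : 'M[C]_n) : A \is unitarymx -> adjmx A *m A = 1%:M.
Proof. by move/mul_adjmx/mulmx1C. Qed.

Lemma tens_unitarymx m n (A : 'M[C]_m) (B : 'M[C]_n) :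
  A \is unitarymx -> B \is unitarymx -> A *t B \is unitarymx.
Proof.
move=> /mul_adjmx hA /mul_adjmx hB; apply/unitarymxP.
by rewrite adjmx_tens tensmx_mul hA hB tensmx11.
Qed.

Lemma scale_unitarymx n a (A : 'M[C]_n) :
  `|a| = 1 -> A \is unitarymx -> a *: A \is unitarymx.
Proof.
move=> ha /mul_adjmx hA; apply/unitarymxP.
by rewrite adjmxZ -scalemxAl -scalemxAr scalerA hA -normCK ha expr1n scale1r.
Qed.

Lemma mxtrace_adj n (A : 'M[C]_n) : \tr (adjmx A) = Num.conj (\tr A).
Proof. by rewrite /mxtrace rmorph_sum; apply: eq_bigr => i _; rewrite !mxE. Qed.

(** Cyclicity of the trace cancels [V] and [W]. This is how the local unitaries of a KAK
    decomposition preserve trace orthogonality. *)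
Lemma mxtrace_adj_unitary n (V W A B : 'M[C]_n) :
  V \is unitarymx -> W \is unitarymx ->
  \tr (adjmx (V *m A *m W) *m (V *m B *m W)) = \tr (adjmx A *m B).
Proof.
move=> uV uW; rewrite mulmxA mxtrace_mulC !adjmx_mul !mulmxA mul_adjmx // mul1mx.
by rewrite -(mulmxA (adjmx A)) mul_adjmxV // mulmx1.
Qed.

End Adjoint.

(** * Tensor products of superoperators: bilinearity and composition *)

Section Superoperators.
Variable R : realType.
Local Notation C := R[i].

(** Each matrix unit of the tensor space is a Kronecker product of matrix units, so Kronecker
    products span. *)
Lemma superop_tens_ext n p m (F G : superop R (n * p) m) :
  (forall X Y, F (X *t Y) = G (X *t Y)) -> F = G.
Proof.
move=> FG; apply/lfunP => X; rewrite (matrix_sum_delta X) !linear_sum.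
apply: eq_bigr => r _; rewrite !linear_sum; apply: eq_bigr => s _; rewrite !linearZ.
case: (mxtens_indexP r) => i k; case: (mxtens_indexP s) => j l.
by rewrite delta_mx_tens; congr (_ *: _); apply: FG.
Qed.

Lemma superopD n m (F G : superop R n m) X : (F + G) X = F X + G X.
Proof. exact: add_lfunE. Qed.

Lemma superopN n m (F : superop R n m) X : (- F) X = - F X.
Proof. exact: opp_lfunE. Qed.

Lemma superopZ n m a (F : superop R n m) X : (a *: F) X = a *: F X.
Proof. exact: scale_lfunE. Qed.

Lemma tens_opDl n m p q (F F' : superop R n m) (G : superop R p q) :
  tens_op (F + F') G = tens_op F G + tens_op F' G.
Proof.
apply: superop_tens_ext => X Y; apply: etrans (tens_opE _ _ _ _) _.
rewrite (superopD F F' X); apply: etrans (tensmxDl _ _ _) (esym _); apply: etrans (superopD _ _ _) _.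
exact: congr2 (tens_opE F G X Y) (tens_opE F' G X Y).
Qed.

Lemma tens_opDr n m p q (F : superop R n m) (G G' : superop R p q) :
  tens_op F (G + G') = tens_op F G + tens_op F G'.
Proof.
apply: superop_tens_ext => X Y; apply: etrans (tens_opE _ _ _ _) _.
rewrite (superopD G G' Y); apply: etrans (tensmxDr _ _ _) (esym _); apply: etrans (superopD _ _ _) _.
exact: congr2 (tens_opE F G X Y) (tens_opE F G' X Y).
Qed.

Lemma tens_opZl n m p q a (F : superop R n m) (G : superop R p q) :
  tens_op (a *: F) G = a *: tens_op F G.
Proof.
apply: superop_tens_ext => X Y; apply: etrans (tens_opE _ _ _ _) _.
rewrite (superopZ a F X); apply: etrans (tensmxZl _ _ _) (esym _); apply: etrans (superopZ _ _ _) _.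
by rewrite (tens_opE F G X Y).
Qed.

Lemma tens_opZr n m p q a (F : superop R n m) (G : superop R p q) :
  tens_op F (a *: G) = a *: tens_op F G.
Proof.
apply: superop_tens_ext => X Y; apply: etrans (tens_opE _ _ _ _) _.
rewrite (superopZ a G Y); apply: etrans (tensmxZr _ _ _) (esym _); apply: etrans (superopZ _ _ _) _.
by rewrite (tens_opE F G X Y).
Qed.

Lemma tens_opNl n m p q (F : superop R n m) (G : superop R p q) :
  tens_op (- F) G = - tens_op F G.
Proof.
apply: superop_tens_ext => X Y; apply: etrans (tens_opE _ _ _ _) _.
rewrite (superopN F X); apply: etrans (tensmxNl _ _) (esym _); apply: etrans (superopN _ _) _.
by rewrite (tens_opE F G X Y).
Qed.

Lemma tens_opNr n m p q (F : superop R n m) (G : superop R p q) :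
  tens_op F (- G) = - tens_op F G.
Proof.
apply: superop_tens_ext => X Y; apply: etrans (tens_opE _ _ _ _) _.
rewrite (superopN G Y); apply: etrans (tensmxNr _ _) (esym _); apply: etrans (superopN _ _) _.
by rewrite (tens_opE F G X Y).
Qed.

Lemma tens_op_comp n m r p q s (F : superop R n m) (F' : superop R m r)
    (G : superop R p q) (G' : superop R q s) :
  (tens_op F' G' \o tens_op F G)%VF = tens_op (F' \o F)%VF (G' \o G)%VF.
Proof. by apply: superop_tens_ext => X Y; rewrite comp_lfunE 3!tens_opE 2!comp_lfunE. Qed.

Lemma tens_op1 n p : tens_op (\1 : superop R n n)%VF (\1 : superop R p p)%VF = \1%VF.
Proof. by apply: superop_tens_ext => X Y; rewrite tens_opE 3!id_lfunE. Qed.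

(** * Positive semidefinite matrices *)

Lemma psdD n (A B : 'M[C]_n) : psd A -> psd B -> psd (A + B).
Proof. by move=> hA hB v; rewrite mulmxDr mulmxDl mxE addr_ge0. Qed.

Lemma psd_congr m n (K : 'M[C]_(m, n)) A : psd A -> psd (K *m A *m adjmx K).
Proof.
move=> hA v; have := hA (adjmx K *m v).
by rewrite adjmx_mul adjmxK !mulmxA.
Qed.

Lemma psd_diag_ge0 n (A : 'M[C]_n) i : psd A -> 0 <= A i i.
Proof.
move=> hA; have := hA (delta_mx i 0).
by rewrite adjmx_delta -rowE -colE !mxE.
Qed.

Lemma psd_tr_ge0 n (A : 'M[C]_n) : psd A -> 0 <= \tr A.
Proof. by move=> hA; apply: sumr_ge0 => i _; apply: psd_diag_ge0. Qed.

Lemma psd_mul_adjmx m n (B : 'M[C]_(m, n)) : psd (B *m adjmx B).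
Proof.
move=> v; have -> : adjmx v *m (B *m adjmx B) *m v = adjmx (adjmx B *m v) *m (adjmx B *m v).
  by rewrite adjmx_mul adjmxK !mulmxA.
rewrite mxE; apply: sumr_ge0 => i _; rewrite mxE [X in Num.conj X]mxE mulrC.
exact: mul_conjC_ge0.
Qed.

(* [1 - M M^*] is an orthogonal projector. *)
Lemma psd_tr_compress m n (A : 'M[C]_m) (M : 'M[C]_(m, n)) :
  psd A -> adjmx M *m M = 1%:M -> \tr (adjmx M *m A *m M) <= \tr A.
Proof.
move=> hA hM; set Q := 1%:M - M *m adjmx M.
have QQ : Q *m Q = Q.
  rewrite /Q mulmxBl mul1mx mulmxBr mulmx1.
  rewrite (_ : M *m adjmx M *m (M *m adjmx M) = M *m adjmx M) ?subrr ?subr0 //.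
  by rewrite mulmxA -(mulmxA M) hM mulmx1.
have Qa : adjmx Q = Q by rewrite adjmxB adjmx1 adjmx_mul adjmxK.
(* As [Q] is a Hermitian idempotent, the trace of Q A Q equals tr (Q A), which is the difference of
   the two sides of the claim. *)
have := psd_tr_ge0 (psd_congr Q hA).
rewrite Qa mxtrace_mulC mulmxA QQ /Q mulmxBl mul1mx linearB /= subr_ge0.
by rewrite (mxtrace_mulC (adjmx M *m A) M) mulmxA.
Qed.

(* Polarization: the quadratic form takes real values at [v + w] and [v + i w]. *)
Lemma psd_form_conj n (A : 'M[C]_n) (v w : 'cV[C]_n) : psd A ->
  Num.conj ((adjmx v *m A *m w) 0 0) = (adjmx w *m A *m v) 0 0.
Proof.
move=> hA; pose f (x y : 'cV[C]_n) : C := (adjmx x *m A *m y) 0 0.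
have fDl x y z : f (x + y) z = f x z + f y z by rewrite /f adjmxD 2!mulmxDl mxE.
have fDr x y z : f x (y + z) = f x y + f x z by rewrite /f mulmxDr mxE.
have fZl c x y : f (c *: x) y = Num.conj c * f x y by rewrite /f adjmxZ -2!scalemxAl mxE.
have fZr c x y : f x (c *: y) = c * f x y by rewrite /f -scalemxAr mxE.
have fR x : f x x \is Num.real by apply/ger0_real/hA.
have h c : c * f v w + Num.conj c * f w v \is Num.real.
  rewrite (_ : _ + _ = f (v + c *: w) (v + c *: w) - f v v - c * Num.conj c * f w w).
    by apply: rpredB; [apply: rpredB|apply: rpredM]; rewrite ?fR ?ger0_real ?mul_conjC_ge0.
  rewrite fDl 2!fDr 2!fZl 2!fZr.
  by move: (f v v) (f v w) (f w v) (f w w) (Num.conj c) => *; ring.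
(* Reality at c = 1 and at c = i gives two linear equations in the conjugates of [f v w] and
   [f w v]; a combination of them isolates the former. *)
have /CrealP := h 1; have /CrealP := h 'i.
rewrite !rmorphD !rmorphM /= !conjCK conjCi rmorph1 !mul1r => e2 e1.
apply: (@mulfI _ (2 * 'i)); first by rewrite mulf_neq0 ?neq0Ci ?pnatr_eq0.
rewrite -/(f v w) -/(f w v).
have -> : 2 * 'i * Num.conj (f v w) = 'i * (Num.conj (f v w) + Num.conj (f w v)) -
   (- 'i * Num.conj (f v w) + 'i * Num.conj (f w v)) by ring.
by rewrite e1 e2; ring.
Qed.

(** [psd] constrains only the quadratic form, so Hermiticity is derived: entries are values of the
    sesquilinear form at basis vectors. *)
Lemma psd_hermsym n (A : 'M[C]_n) : psd A -> adjmx A = A.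
Proof.
move=> hA; apply/matrixP => i j; rewrite !mxE.
have fE k l : A k l = (adjmx (delta_mx k 0 : 'cV[C]_n) *m A *m (delta_mx l 0 : 'cV[C]_n)) 0 0.
  by rewrite adjmx_delta -rowE !mxE (bigD1 l) //= big1 ?addr0 => [|x /negPf xl];
    rewrite !mxE ?eqxx ?mulr1 // xl mulr0.
by rewrite (fE j i) (fE i j); apply: psd_form_conj.
Qed.

(** A Hermitian matrix is normal, hence unitarily diagonalizable; its eigenvalues are diagonal
    entries of a congruent matrix, hence nonnegative. *)
Lemma psd_spectral n (A : 'M[C]_n) : psd A ->
  exists (P : 'M[C]_n) (d : 'I_n -> C),
    [/\ P \is unitarymx, forall i, 0 <= d i & A = \sum_i d i *: (col i P *m adjmx (col i P))].
Proof.
move=> hA; have hn : A \is normalmx.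
  by apply/normalmxP; rewrite (psd_hermsym hA).
have /orthomx_spectralP hS := hn.
set P := spectralmx A in hS; set D := spectral_diag A in hS.
have hP : P \is unitarymx by apply: spectral_unitarymx.
exists (adjmx P), (fun i => D 0 i); split.
- by rewrite trmxC_unitary.
- move=> i; have := psd_diag_ge0 i (psd_congr P hA).
  rewrite {1}hS (invmx_unitary hP) !mulmxA mul_adjmx // mul1mx -mulmxA mul_adjmx // mulmx1.
  by rewrite !mxE eqxx.
rewrite hS (invmx_unitary hP); apply/matrixP => i j; rewrite mul_mx_diag !mxE summxE.
apply: eq_bigr => k _; rewrite !mxE big_ord1 !mxE conjCK.
by rewrite mulrAC [RHS]mulrC.
Qed.

(** The pairing is tr (P Q^T). A spectral decomposition of [P] turns it into a nonnegative
    combination of values of the quadratic form of [Q] at the conjugated eigenvectors. *)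
Lemma psd_pairing_ge0 n (P Q : 'M[C]_n) : psd P -> psd Q ->
  0 <= \sum_i \sum_j P i j * Q i j.
Proof.
move=> /psd_spectral [V [d [_ d0 ->]]] hQ.
rewrite (_ : \sum_i _ = \sum_k d k *
    (adjmx (map_mx Num.conj (col k V)) *m Q *m map_mx Num.conj (col k V)) 0 0).
  by apply: sumr_ge0 => k _; rewrite mulr_ge0 // hQ.
transitivity (\sum_k \sum_i \sum_j d k * (V i k * Q i j * Num.conj (V j k))).
  rewrite [RHS]exchange_big; apply: eq_bigr => i _.
  rewrite [RHS]exchange_big; apply: eq_bigr => j _.
  rewrite summxE mulr_suml; apply: eq_bigr => k _.
  rewrite !mxE big_ord1 !mxE; ring.
apply: eq_bigr => k _; rewrite mxE mulr_sumr exchange_big; apply: eq_bigr => j _.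
rewrite !mxE mulr_suml mulr_sumr; apply: eq_bigr => i _.
by rewrite !mxE conjCK; ring.
Qed.

(** The Rayleigh quotient of [Q] at a nonzero vector is the trace of a compression of [Q] to a line,
    which [psd_tr_compress] bounds by [\tr Q]. *)
Lemma psd_le_tr n (Q : 'M[C]_n) : psd Q -> psd ((\tr Q)%:M - Q).
Proof.
move=> hQ v.
rewrite mulmxBr mulmxBl mxE [X in _ + X]mxE subr_ge0 mul_mx_scalar -scalemxAl [leRHS]mxE.
have N0 : 0 <= (adjmx v *m v) 0 0.
  have := @psd_mul_adjmx 1 n (adjmx v) 1%:M.
  by rewrite adjmx1 adjmxK mul1mx mulmx1.
have [v0|vN0] := eqVneq ((adjmx v *m v) 0 0) 0.
  suff -> : v = 0 by rewrite !mulmx0 !mxE mulr0.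
  have hk k : 0 <= adjmx v 0 k * v k 0 by rewrite !mxE mulrC mul_conjC_ge0.
  apply/colP => i; move: v0; rewrite mxE => /psumr_eq0P h.
  have /eqP := h (fun k _ => hk k) i isT.
  by rewrite !mxE mulrC mul_conjC_eq0 => /eqP.
set t := (adjmx v *m v) 0 0 in N0 vN0 *.
have t0 : 0 < t by rewrite lt_def vN0.
pose w := (sqrtC t)^-1 *: v.
have cw : Num.conj (sqrtC t)^-1 = (sqrtC t)^-1.
  by apply/CrealP/ger0_real; rewrite invr_ge0 sqrtC_ge0.
have hw : adjmx w *m w = 1%:M.
  rewrite adjmxZ -scalemxAl -scalemxAr scalerA cw -invfM -expr2 sqrtCK.
  by rewrite [_ *m v]mx11_scalar -/t scale_scalar_mx mulVf.
have := psd_tr_compress hQ hw.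
rewrite adjmxZ cw -!scalemxAl -scalemxAr scalerA -invfM -expr2 sqrtCK mxtraceZ trace_mx11.
by rewrite mulrC ler_pdivrMr.
Qed.

(** Pair [P] with the positive semidefinite matrix [(\tr Q)%:M - Q]; the scalar part contributes the
    product of the traces. *)
Lemma psd_pairing_le n (P Q : 'M[C]_n) : psd P -> psd Q ->
  \sum_i \sum_j P i j * Q i j <= \tr P * \tr Q.
Proof.
move=> hP hQ; have := psd_pairing_ge0 hP (psd_le_tr hQ).
rewrite (_ : \sum_i _ = \tr P * \tr Q - \sum_i \sum_j P i j * Q i j) ?subr_ge0 //.
rewrite mulr_suml -sumrB; apply: eq_bigr => i _.
rewrite -[P i i * _](_ : \sum_j P i j * ((\tr Q)%:M i j) = _).
  by rewrite -sumrB; apply: eq_bigr => j _; rewrite !mxE mulrBr.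
rewrite (bigD1 i) //= big1 ?addr0 ?mxE ?eqxx ?mulr1n // => j /negPf ij.
by rewrite mxE eq_sym ij mulr0n mulr0.
Qed.
End Superoperators.

(** * Completely positive maps, Choi matrices and Gram matrices *)

Section CompletelyPositive.
Variable R : realType.
Local Notation C := R[i].

(** [unitary_channel U] unfolds to the same term as [sandwich U U]; two different operators are
    allowed so that the off-diagonal terms of an expansion are covered. *)
Definition sandwich n (L M : 'M[C]_n) : superop R n n :=
  linfun (mulmxr (adjmx M) \o mulmx L).

Lemma sandwichE n (L M X : 'M[C]_n) : sandwich L M X = L *m X *m adjmx M.
Proof. by rewrite /sandwich lfunE. Qed.

Lemma sandwich_tens n p (L M : 'M[C]_n) (L' M' : 'M[C]_p) :
  tens_op (sandwich L M) (sandwich L' M') = sandwich (L *t L') (M *t M').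
Proof.
apply: superop_tens_ext => X Y; apply: etrans (tens_opE _ _ _ _) _.
by rewrite (sandwichE L) (sandwichE L') sandwichE adjmx_tens !tensmx_mul.
Qed.

Lemma sandwich11 n : sandwich 1%:M 1%:M = \1%VF :> superop R n n.
Proof. by apply/lfunP => X; rewrite sandwichE id_lfunE adjmx1 mulmx1 mul1mx. Qed.

Lemma cp_sandwich n (K : 'M[C]_n) : completely_positive (sandwich K K).
Proof.
move=> k X hX; rewrite -sandwich11 sandwich_tens sandwichE; exact: psd_congr.
Qed.

Lemma cp_id n : completely_positive (\1%VF : superop R n n).
Proof. by rewrite -sandwich11; apply: cp_sandwich. Qed.

Lemma cpD n m (F G : superop R n m) :
  completely_positive F -> completely_positive G -> completely_positive (F + G).
Proof.
move=> hF hG k X hX; rewrite tens_opDr superopD.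
by apply: psdD; [apply: hF|apply: hG].
Qed.

Lemma cp_comp n m p (F : superop R n m) (G : superop R m p) :
  completely_positive F -> completely_positive G -> completely_positive (G \o F)%VF.
Proof.
move=> hF hG k X hX.
rewrite (_ : tens_op _ _ = (tens_op \1 G \o tens_op \1 F)%VF).
  by rewrite comp_lfunE; apply: hG; apply: hF.
by rewrite tens_op_comp comp_lfun1l.
Qed.

(** The unnormalized Choi matrix sum_ij E_ij (x) F(E_ij), with the input factor first. *)
Definition choi n m (F : superop R n m) : 'M[C]_(n * m) :=
  \matrix_(r, s) F (delta_mx (mxtens_unindex r).1 (mxtens_unindex s).1)
    (mxtens_unindex r).2 (mxtens_unindex s).2.

Lemma choiE n m (F : superop R n m) i a j b :
  choi F (mxtens_index (i, a)) (mxtens_index (j, b)) = F (delta_mx i j) a b.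
Proof. by rewrite mxE !mxtens_indexK. Qed.

(** The Choi matrix is the image under id (x) F of the rank-one matrix of [om], the unnormalized
    maximally entangled vector. *)
Lemma psd_choi n m (F : superop R n m) : completely_positive F -> psd (choi F).
Proof.
move=> hF; pose om : 'cV[C]_(n * n) := \col_r ((mxtens_unindex r).1 == (mxtens_unindex r).2)%:R.
have omE : om *m adjmx om = \sum_i \sum_j delta_mx i j *t delta_mx i j.
  apply/matrixP => r s; case: (mxtens_indexP r) => i k; case: (mxtens_indexP s) => j l.
  rewrite !mxE big_ord1 !mxE !mxtens_indexK /= rmorph_nat summxE.
  rewrite (bigD1 i) //= [X in _ + X]big1 ?addr0; last first.
    move=> i' /negPf hi; rewrite summxE big1 // => j' _.
    by rewrite tensmxE !mxE (eq_sym i) hi mul0r.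
  rewrite summxE (bigD1 j) //= big1 ?addr0; last first.
    by move=> j' /negPf hj; rewrite tensmxE !mxE (eq_sym j) hj andbF mul0r.
  by rewrite tensmxE !mxE !eqxx mul1r -natrM mulnb (eq_sym i) (eq_sym j).
have := hF _ _ (psd_mul_adjmx om); rewrite omE linear_sum.
suff -> : \sum_i tens_op \1%VF F (\sum_j delta_mx i j *t delta_mx i j) = choi F by [].
apply/matrixP => r s; case: (mxtens_indexP r) => i a; case: (mxtens_indexP s) => j b.
rewrite choiE summxE (bigD1 i) //= linear_sum summxE (bigD1 j) //= tens_opE id_lfunE.
rewrite tensmxE mxE !eqxx mul1r.
rewrite big1 => [|j' /negPf hj]; last first.
  by rewrite tens_opE id_lfunE tensmxE mxE (eq_sym j) hj andbF mul0r.
rewrite big1 ?addr0 // => i' /negPf hi; rewrite linear_sum summxE big1 // => j' _.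
by rewrite /= tens_opE id_lfunE tensmxE mxE (eq_sym i) hi mul0r.
Qed.

Lemma mxtrace_choi n m (F : superop R n m) : \tr (choi F) = \tr (F 1%:M).
Proof.
rewrite /mxtrace big_mxtens_index (_ : 1%:M = \sum_i delta_mx i i).
  rewrite linear_sum exchange_big; apply: eq_bigr => a _; rewrite summxE.
  by apply: eq_bigr => i _; rewrite choiE.
apply/matrixP => i j; rewrite mxE summxE (bigD1 i) //= big1 => [|k /negPf hk].
  by rewrite mxE eqxx addr0 eq_sym.
by rewrite mxE (eq_sym i) hk.
Qed.

(* The sesquilinear form that the unnormalized Choi matrix of [F] defines on operators. *)
Definition choi_form n m (M N : 'M[C]_(m, n)) (F : superop R n m) : C :=
  \sum_p \sum_q (adjmx M *m F (delta_mx p q) *m N) p q.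

Lemma choi_form_tens n m p q (M N : 'M[C]_(m, n)) (M' N' : 'M[C]_(q, p))
    (F : superop R n m) (G : superop R p q) :
  choi_form (M *t M') (N *t N') (tens_op F G) = choi_form M N F * choi_form M' N' G.
Proof.
rewrite /choi_form big_mxtens_index mulr_suml; apply: eq_bigr => i _.
rewrite mulr_sumr; apply: eq_bigr => k _.
rewrite big_mxtens_index mulr_suml; apply: eq_bigr => j _.
rewrite mulr_sumr; apply: eq_bigr => l _.
by rewrite delta_mx_tens tens_opE adjmx_tens !tensmx_mul tensmxE.
Qed.

Lemma mulmx_delta m n p q (A : 'M[C]_(m, n)) (B : 'M[C]_(p, q)) i j r s :
  (A *m delta_mx i j *m B) r s = A r i * B j s.
Proof.
rewrite -(mul_delta_mx (0 : 'I_1)) mulmxA -mulmxA -colE -rowE.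
by rewrite mxE big_ord1 !mxE.
Qed.

(** The Choi matrix of a unitary channel is the rank-one matrix |U><U|, so the form splits into two
    trace inner products. *)
Lemma choi_form_unitary n (M N U : 'M[C]_n) :
  choi_form M N (unitary_channel U) = \tr (adjmx M *m U) * \tr (adjmx U *m N).
Proof.
rewrite /choi_form /mxtrace mulr_suml; apply: eq_bigr => p _.
rewrite mulr_sumr; apply: eq_bigr => q _.
by rewrite unitary_channelE !mulmxA -[_ *m N]mulmxA mulmx_delta.
Qed.

Lemma choi_formD n m (M N : 'M[C]_(m, n)) : {morph choi_form M N : F G / F + G}.
Proof.
move=> F G; rewrite /choi_form -big_split; apply: eq_bigr => p _.
rewrite -big_split; apply: eq_bigr => q _.
by rewrite superopD mulmxDr mulmxDl mxE.
Qed.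

Lemma choi_formZ n m (M N : 'M[C]_(m, n)) a F :
  choi_form M N (a *: F) = a * choi_form M N F.
Proof.
rewrite /choi_form mulr_sumr; apply: eq_bigr => p _.
rewrite mulr_sumr; apply: eq_bigr => q _.
by rewrite superopZ -scalemxAr -scalemxAl mxE.
Qed.

Section Gram.
Variables (n m N : nat) (L : 'I_N -> 'M[C]_(m, n)).

Definition gram (F : superop R n m) : 'M[C]_N := \matrix_(k, l) choi_form (L k) (L l) F.

(** The columns are the vectorized [L k], input index first as in [choi]; through [V] the Gram
    matrix is a congruence of the Choi matrix. *)
Let V : 'M[C]_(n * m, N) := \matrix_(r, k) L k (mxtens_unindex r).2 (mxtens_unindex r).1.

Let gramE F : gram F = adjmx V *m choi F *m V.
Proof.
apply/matrixP => k l; rewrite !mxE.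
rewrite /choi_form exchange_big big_mxtens_index; apply: eq_bigr => j _.
under eq_bigr => i _ do rewrite !mxE.
rewrite exchange_big; apply: eq_bigr => b _.
rewrite mxE big_mxtens_index -mulr_suml [V _ _]mxE mxtens_indexK; congr (_ * _).
apply: eq_bigr => i _; rewrite mxE; apply: eq_bigr => a _.
by rewrite choiE !mxE mxtens_indexK.
Qed.

Lemma psd_gram F : completely_positive F -> psd (gram F).
Proof.
by move=> /psd_choi hF; rewrite gramE -{2}[V]adjmxK; apply: psd_congr.
Qed.

(** Orthogonality makes [V] divided by the square root of [c] an isometry, and compression by an
    isometry does not increase the trace of the Choi matrix. *)
Lemma tr_gram_le c F : 0 < c ->
  (forall k l, \tr (adjmx (L k) *m L l) = c * (k == l)%:R) ->
  completely_positive F -> \tr (gram F) <= c * \tr (F 1%:M).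
Proof.
move=> c0 hL /psd_choi hF; pose W := (sqrtC c)^-1 *: V.
have cc : Num.conj (sqrtC c)^-1 = (sqrtC c)^-1.
  by apply/CrealP/ger0_real; rewrite invr_ge0 sqrtC_ge0 ltW.
have VV : adjmx V *m V = c%:M.
  apply/matrixP => k l; rewrite [RHS]mxE -mulr_natr -hL mxE big_mxtens_index.
  apply: eq_bigr => i _; rewrite mxE; apply: eq_bigr => a _.
  by rewrite !mxE mxtens_indexK.
have hW : adjmx W *m W = 1%:M.
  rewrite adjmxZ -scalemxAl -scalemxAr scalerA cc -invfM -expr2 sqrtCK VV.
  by rewrite scale_scalar_mx mulVf ?gt_eqF.
have := psd_tr_compress hF hW.
rewrite adjmxZ cc -!scalemxAl -scalemxAr scalerA -invfM -expr2 sqrtCK.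
by rewrite mxtraceZ -gramE mxtrace_choi mulrC ler_pdivrMr // [c * _]mulrC.
Qed.

End Gram.

End CompletelyPositive.

(** * Signed separable maps, a common relaxation of LO and LOCC *)

Section Separable.
Variable R : realType.
Local Notation C := R[i].

Definition cp_product a b c d (F : superop R (a * b) (c * d)) : Prop :=
  exists (A : superop R a c) (B : superop R b d),
    [/\ completely_positive A, completely_positive B & F = tens_op A B].

(** A superset of LO and of LOCC that forgets the protocol and keeps what the lower bound uses. *)
Definition signed_separable a b : set (superop R (a * b) (a * b)) :=
  [set F | exists (J : finType) (G : J -> superop R (a * b) (a * b)) (s : J -> bool),
    [/\ forall j, cp_product (G j), trace_preserving (\sum_j G j)
      & F = \sum_j (-1) ^+ s j *: G j]].

Lemma cp_product_comp a b a' b' c d (F : superop R (a * b) (a' * b'))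
    (G : superop R (a' * b') (c * d)) :
  cp_product F -> cp_product G -> cp_product (G \o F)%VF.
Proof.
move=> [A [B [hA hB ->]]] [A' [B' [hA' hB' ->]]].
exists (A' \o A)%VF, (B' \o B)%VF; split; [exact: cp_comp|exact: cp_comp|].
exact: tens_op_comp.
Qed.

Lemma trace_preserving_tens_ext n p m (F : superop R (n * p) m) :
  (forall X Y, \tr (F (X *t Y)) = \tr X * \tr Y) -> trace_preserving F.
Proof.
move=> hF X; rewrite (matrix_sum_delta X) !linear_sum /=.
apply: eq_bigr => r _; rewrite !linear_sum /=; apply: eq_bigr => s _; rewrite !linearZ /=.
case: (mxtens_indexP r) => i k; case: (mxtens_indexP s) => j l.
by rewrite delta_mx_tens hF mxtrace_tens.
Qed.

Lemma one_way_fromA_product (I : finType) a b a' b' (E : I -> superop R (a * b) (a' * b')) :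
  one_way_fromA E -> (forall i, cp_product (E i)) /\ trace_preserving (\sum_i E i).
Proof.
move=> [A [B [[cpA tpA] hB EE]]]; split=> [i|].
  by exists (A i), (B i); split=> //; case: (hB i).
apply: trace_preserving_tens_ext => X Y; rewrite sum_lfunE raddf_sum /=.
rewrite -tpA sum_lfunE raddf_sum /= mulr_suml; apply: eq_bigr => i _.
by rewrite EE tens_opE mxtrace_tens; case: (hB i) => _ ->.
Qed.

Lemma one_way_fromB_product (I : finType) a b a' b' (E : I -> superop R (a * b) (a' * b')) :
  one_way_fromB E -> (forall i, cp_product (E i)) /\ trace_preserving (\sum_i E i).
Proof.
move=> [A [B [[cpB tpB] hA EE]]]; split=> [i|].
  by exists (A i), (B i); split=> //; case: (hA i).
apply: trace_preserving_tens_ext => X Y; rewrite sum_lfunE raddf_sum /=.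
rewrite -(tpB Y) sum_lfunE raddf_sum /= mulr_sumr; apply: eq_bigr => i _.
by rewrite EE tens_opE mxtrace_tens; case: (hA i) => _ ->.
Qed.

(** Induction on the protocol tree. Products compose to products. The total is a nested sum whose
    inner sums preserve the trace by induction, which leaves the total of the first round. *)
Lemma LOCC_rounds_product c d a b (I : finType) (E : I -> superop R (a * b) (c * d)) :
  LOCC_rounds E -> (forall i, cp_product (E i)) /\ trace_preserving (\sum_i E i).
Proof.
elim=> {a b I E} [|a b a' b' I E J F hE _ IH].
  split=> [_|X]; last by rewrite sum_lfunE raddf_sum big_const card_unit /= addr0 id_lfunE.
  exists \1%VF, \1%VF; split; [exact: cp_id|exact: cp_id|].
  by rewrite tens_op1.
have {hE} [cpE tpE] : (forall i, cp_product (E i)) /\ trace_preserving (\sum_i E i).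
  by case: hE => [/one_way_fromA_product|/one_way_fromB_product].
split=> [[i j]|X] /=.
  by apply: cp_product_comp => //; case: (IH i).
rewrite -tpE !sum_lfunE !raddf_sum /=.
transitivity (\sum_(i : I) \sum_(j : J i) \tr (F i j (E i X))).
  rewrite [RHS]sig_big_dep /=; apply: eq_big => // -[i j] _; by rewrite comp_lfunE.
apply: eq_bigr => i _; case: (IH i) => _ <-.
by rewrite sum_lfunE raddf_sum.
Qed.

(** Coarse-graining is undone by giving each fine outcome [j] the sign of its class [f j]. *)
Lemma LOCC_separable a b : LOCC (R := R) a b `<=` @signed_separable a b.
Proof.
move=> F [I [E [s [[J [G [f [/LOCC_rounds_product [cpG tpG] EG]]]] ->]]]].
exists J, G, (s \o f); split=> //=.
transitivity (\sum_i \sum_(j | f j == i) (-1) ^+ s i *: G j).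
  by apply: eq_bigr => i _; rewrite EG scaler_sumr.
rewrite (exchange_big_dep predT) //=; apply: eq_bigr => j _.
by rewrite (eq_bigl (pred1 (f j))) ?big_pred1_eq // => i; rewrite eq_sym.
Qed.

Lemma trace_preserving_id n : trace_preserving (\1%VF : superop R n n).
Proof. by move=> X; rewrite id_lfunE. Qed.

Lemma cptp_id n : CPTP (\1%VF : superop R n n).
Proof. by split; [exact: cp_id|exact: trace_preserving_id]. Qed.

Lemma signed_instrument n m (Fp Fm : superop R n m) :
  completely_positive Fp -> completely_positive Fm -> trace_preserving (Fp + Fm) ->
  instrument (fun x : bool => if x then Fm else Fp).
Proof.
move=> cpp cpm tp; split; first by case.
by move=> X; rewrite big_bool -[RHS]tp !superopD addrC.
Qed.

Lemma sum_signed_bool (K : pzRingType) (V : lmodType K) (T : bool -> bool -> V) :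
  \sum_x \sum_y (-1) ^+ (x (+) y) *: T x y =
  T false false - T false true + (- T true false + T true true).
Proof.
rewrite !big_bool /= expr0 expr1 !scale1r !scaleN1r.
by rewrite addrC [_ + T false false]addrC [_ + T true true]addrC.
Qed.

(** A two-round protocol: A measures whether its positive or its negative part occurs, then B does
    the same. The two signs multiply, which is the exclusive or of the outcomes. *)
Lemma LO_LOCC a b : LO (R := R) a b `<=` LOCC a b.
Proof.
move=> F [A [B [[Ap [Am [cpAp cpAm [_ tpA] ->]]] [Bp [Bm [cpBp cpBm [_ tpB] ->]]] ->]]].
have iA := signed_instrument cpAp cpAm tpA; have iB := signed_instrument cpBp cpBm tpB.
set fA := (fun x : bool => if x then Am else Ap) in iA.
set fB := (fun x : bool => if x then Bm else Bp) in iB.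
pose EA x : superop R (a * b) (a * b) := tens_op (fA x) \1%VF.
pose EB x : superop R (a * b) (a * b) := tens_op \1%VF (fB x).
(* The nested pair type and the trailing identity are what [LOCC_roundsS], used twice, and then
   [LOCC_rounds0] produce. *)
pose J (_ : bool) : finType := {_ : bool & unit}.
pose E : {x : bool & J x} -> superop R (a * b) (a * b) :=
  fun p => ((\1 \o EB (tag (tagged p))) \o EA (tag p))%VF.
have hE : LOCC_rounds E.
  apply: (@LOCC_roundsS _ a b a b a b bool EA J (fun _ p => (\1 \o EB (tag p))%VF)).
    left; exists fA, (fun=> \1%VF); split; [exact: iA|by move=> _; exact: cptp_id|by []].
  move=> x; apply: (@LOCC_roundsS _ a b a b a b bool EB (fun=> unit) (fun _ _ => \1%VF)).
    right; exists (fun=> \1%VF), fB; split; [exact: iB|by move=> _; exact: cptp_id|by []].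
  by move=> _; apply: LOCC_rounds0.
exists {x : bool & J x}, E, (fun p => tag p (+) tag (tagged p)); split.
  exists {x : bool & J x}, E, id; split=> [//|i].
  by rewrite big_pred1_eq.
transitivity (\sum_x \sum_y (-1) ^+ (x (+) y) *: tens_op (fA x) (fB y)).
  by rewrite sum_signed_bool tens_opDl !tens_opDr !tens_opNl !tens_opNr opprK.
transitivity (\sum_x \sum_(p : J x) (-1) ^+ (x (+) tag p) *: tens_op (fA x) (fB (tag p))).
  apply: eq_bigr => x _.
  transitivity (\sum_y \sum_(t : unit) (-1) ^+ (x (+) y) *: tens_op (fA x) (fB y)).
    by apply: eq_bigr => y _; rewrite big_const card_unit /= addr0.
  by rewrite [LHS]sig_big_dep /=; apply: eq_big.
rewrite [LHS]sig_big_dep /=; apply: eq_big => [//|[x [y t]] _] /=.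
by rewrite /E /= comp_lfun1l tens_op_comp comp_lfun1l comp_lfun1r.
Qed.

End Separable.

(** * Lower bound by a linear witness *)

Section Witness.
Variable R : realType.
Local Notation C := R[i].
Variables (d N : nat) (L M : 'I_N -> 'M[C]_d) (c : 'I_N -> R).
Hypothesis d_gt0 : (0 < d)%N.
Hypothesis orthL : forall k l, \tr (adjmx (L k) *m L l) = d%:R * (k == l)%:R.
Hypothesis orthM : forall k l, \tr (adjmx (M k) *m M l) = d%:R * (k == l)%:R.

(** This is <Phi|J|Phi>, for J the unnormalized Choi matrix of [F] and Phi = sum_k |L_k>|M_k>. *)
Definition overlap (F : superop R (d * d) (d * d)) : C :=
  \sum_k \sum_l choi_form (L k *t M k) (L l *t M l) F.

(** Here [\tr (F 1%:M)] is tr J. The factor d^2 compensates for [L k] and [M k] having squared norm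
    d each in the trace form. *)
Definition witness (F : superop R (d * d) (d * d)) : C :=
  2 * overlap F - d%:R ^+ 2 * \tr (F 1%:M).

Lemma overlapD : {morph overlap : F G / F + G}.
Proof.
move=> F G; rewrite /overlap -big_split; apply: eq_bigr => k _.
rewrite -big_split; apply: eq_bigr => l _; exact: choi_formD.
Qed.

Lemma overlapZ a F : overlap (a *: F) = a * overlap F.
Proof.
rewrite /overlap mulr_sumr; apply: eq_bigr => k _.
rewrite mulr_sumr; apply: eq_bigr => l _; exact: choi_formZ.
Qed.

Lemma witnessD : {morph witness : F G / F + G}.
Proof.
by move=> F G; rewrite /witness overlapD superopD linearD /= 2!mulrDr opprD addrACA.
Qed.

Lemma witnessZ a F : witness (a *: F) = a * witness F.
Proof. by rewrite /witness overlapZ superopZ mxtraceZ mulrBr (mulrCA 2) (mulrCA (_ ^+ 2)). Qed.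

Lemma witness_sum (I : finType) (F : I -> superop R (d * d) (d * d)) :
  witness (\sum_i F i) = \sum_i witness (F i).
Proof.
by apply: (big_morph _ witnessD); rewrite -(scale0r 0) witnessZ mul0r.
Qed.

(** On a product map the overlap is the entrywise pairing of the Gram matrices of both factors,
    whose traces are at most d times those of [A 1%:M] and [B 1%:M]. *)
Lemma overlap_product_bounds F : cp_product F ->
  0 <= overlap F <= d%:R ^+ 2 * \tr (F 1%:M).
Proof.
move=> [A [B [cpA cpB ->]]].
have d0 : 0 < d%:R :> C by rewrite ltr0n.
rewrite (_ : overlap _ = \sum_k \sum_l gram L A k l * gram M B k l); last first.
  apply: eq_bigr => k _; apply: eq_bigr => l _; rewrite !mxE; exact: choi_form_tens.
have gA := psd_gram L cpA; have gB := psd_gram M cpB.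
rewrite psd_pairing_ge0 //=; apply: le_trans (psd_pairing_le gA gB) _.
rewrite -tensmx11 tens_opE mxtrace_tens expr2 mulrACA.
by apply: ler_pM; [exact: psd_tr_ge0|exact: psd_tr_ge0|exact: tr_gram_le|exact: tr_gram_le].
Qed.

(** A product term has its witness in [-t, t] with t = d^2 tr (G_j 1), whatever its sign. Trace
    preservation of the total makes these bounds add up to d^2 times d^2. *)
Lemma witness_separable F : signed_separable F -> `|witness F| <= d%:R ^+ 4.
Proof.
move=> [J [G [s [cpG tpG ->]]]]; rewrite witness_sum.
apply: le_trans (ler_norm_sum _ _ _) _.
have -> : d%:R ^+ 4 = \sum_j d%:R ^+ 2 * \tr (G j 1%:M) :> C.
  rewrite -mulr_sumr.
  have := tpG 1%:M; rewrite sum_lfunE raddf_sum /= => ->.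
  by rewrite mxtrace1 natrM -expr2 -exprD.
apply: ler_sum => j _; rewrite witnessZ normrMsign.
have /andP[h0 h1] := overlap_product_bounds (cpG j); have h2 := le_trans h0 h1.
rewrite real_ler_norml /witness.
  apply/andP; split; first by rewrite lerBrDr addNr mulr_ge0.
  by rewrite lerBlDr -[leRHS]mulr2n -[leRHS]mulr_natl ler_pM2l // ltr0n.
by rewrite rpredB ?ger0_real // mulr_ge0.
Qed.

Let U : 'M[C]_(d * d) := \sum_k (c k)%:C *: (L k *t M k).
Hypothesis c_norm : \sum_k c k ^+ 2 = 1.

Let trU k : \tr (adjmx (L k *t M k) *m U) = d%:R ^+ 2 * (c k)%:C.
Proof.
rewrite mulmx_sumr raddf_sum (bigD1 k) //= big1 => [|l /negPf lk].
  rewrite -scalemxAr mxtraceZ adjmx_tens tensmx_mul mxtrace_tens orthL orthM eqxx.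
  by rewrite addr0 !mulr1 -expr2 mulrC.
rewrite -scalemxAr mxtraceZ adjmx_tens tensmx_mul mxtrace_tens orthL orthM eq_sym lk.
by rewrite !mulr0.
Qed.

(** The inner product of Phi with [U] is d^2 sum_k c_k, so the overlap is d^4 (sum_k c_k)^2; the
    trace term is d^4 because the c_k^2 sum to 1. *)
Lemma witness_unitary :
  witness (unitary_channel U) = d%:R ^+ 4 * (2 * (\sum_k c k) ^+ 2 - 1)%:C.
Proof.
have trU' k : \tr (adjmx U *m (L k *t M k)) = d%:R ^+ 2 * (c k)%:C.
  rewrite -{1}[L k *t M k]adjmxK -adjmx_mul mxtrace_adj trU rmorphM rmorphXn rmorph_nat.
  by congr (_ * _); exact: conjc_real.
rewrite /witness.
have -> : overlap (unitary_channel U) = d%:R ^+ 4 * ((\sum_k c k)%:C ^+ 2).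
  rewrite rmorph_sum expr2 mulr_suml mulr_sumr; apply: eq_bigr => k _.
  rewrite mulr_sumr mulr_sumr; apply: eq_bigr => l _.
  by rewrite choi_form_unitary trU trU'; ring.
have -> : \tr (unitary_channel U 1%:M) = d%:R ^+ 2.
  rewrite unitary_channelE mulmx1 mxtrace_mulC {2}/U mulmx_sumr raddf_sum.
  transitivity (\sum_k d%:R ^+ 2 * ((c k ^+ 2)%:C : C)).
    by apply: eq_bigr => k _; rewrite -scalemxAr /= mxtraceZ trU' expr2 rmorphM mulrCA.
  by rewrite -mulr_sumr -rmorph_sum c_norm rmorph1 mulr1.
by rewrite rmorphB rmorphM rmorphXn rmorph1 rmorph_nat; ring.
Qed.

(** Linearity and [witness_separable] bound the witness of any decomposition by d^4 times its cost;
    [witness_unitary] gives the exact value. *)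
Lemma cost_lower_bound :
  lbound (decomposition_costs (@signed_separable R d d) (unitary_channel U))
    (2 * (\sum_k c k) ^+ 2 - 1).
Proof.
move=> _ [m [x [F [_ SF EU ->]]]].
have d0 : 0 < d%:R ^+ 4 :> C by rewrite exprn_gt0 ?ltr0n.
apply: le_trans (ler_norm _) _.
rewrite -lecR -(ler_pM2l d0).
have -> : `|2 * (\sum_k c k) ^+ 2 - 1|%:C = `|(2 * (\sum_k c k) ^+ 2 - 1)%:C| :> C.
  by rewrite normc_def /= expr0n addr0 sqrtr_sqr.
rewrite -{1}(ger0_norm (ltW d0)) -normrM -witness_unitary EU witness_sum.
apply: le_trans (ler_norm_sum _ _ _) _.
rewrite rmorph_sum mulr_sumr; apply: ler_sum => i _.
rewrite witnessZ normrM mulrC.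
have -> : `|(x i)%:C| = `|x i|%:C :> C by rewrite normc_def /= expr0n addr0 sqrtr_sqr.
by apply: ler_wpM2r; [rewrite lecR|apply: witness_separable].
Qed.

End Witness.

(** * Upper bound by an explicit LO decomposition *)

Section LocalDecomposition.
Variable R : realType.
Local Notation C := R[i].

Lemma decomposition_cost_fin n (S : set (superop R n n)) (T : finType)
    (x : T -> R) (F : T -> superop R n n) :
  (0 < #|T|)%N -> (forall t, S (F t)) ->
  decomposition_costs S (\sum_t (x t)%:C *: F t) (\sum_t `|x t|).
Proof.
move=> T0 SF; exists #|T|, (x \o enum_val), (F \o enum_val); split=> //=.
- by rewrite (big_enum_val (A := T)).
- by rewrite (big_enum_val (A := T)).
Qed.

Lemma sandwich_suml n (I : finType) (a : I -> C) (L : I -> 'M[C]_n) M :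
  sandwich (\sum_i a i *: L i) M = \sum_i a i *: sandwich (L i) M.
Proof.
apply/lfunP => X; rewrite sandwichE sum_lfunE !mulmx_suml; apply: eq_bigr => i _.
by rewrite superopZ sandwichE -!scalemxAl.
Qed.

Lemma sandwich_sumr n (I : finType) (a : I -> C) L (M : I -> 'M[C]_n) :
  sandwich L (\sum_i a i *: M i) = \sum_i Num.conj (a i) *: sandwich L (M i).
Proof.
apply/lfunP => X; rewrite sandwichE sum_lfunE adjmx_sum mulmx_sumr; apply: eq_bigr => i _.
by rewrite superopZ sandwichE adjmxZ -!scalemxAr.
Qed.

Lemma sandwichDl n (L L' M : 'M[C]_n) : sandwich (L + L') M = sandwich L M + sandwich L' M.
Proof. by apply/lfunP => X; rewrite superopD !sandwichE !mulmxDl. Qed.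

Lemma sandwichDr n (L M M' : 'M[C]_n) : sandwich L (M + M') = sandwich L M + sandwich L M'.
Proof. by apply/lfunP => X; rewrite superopD !sandwichE adjmxD mulmxDr. Qed.

Lemma sandwichNl n (L M : 'M[C]_n) : sandwich (- L) M = - sandwich L M.
Proof. by apply/lfunP => X; rewrite superopN !sandwichE !mulNmx. Qed.

Lemma sandwichNr n (L M : 'M[C]_n) : sandwich L (- M) = - sandwich L M.
Proof. by apply/lfunP => X; rewrite superopN !sandwichE raddfN map_mxN mulmxN. Qed.

Lemma sandwichZl n a (L M : 'M[C]_n) : sandwich (a *: L) M = a *: sandwich L M.
Proof. by apply/lfunP => X; rewrite superopZ !sandwichE -!scalemxAl. Qed.

Lemma sandwichZr n a (L M : 'M[C]_n) : sandwich L (a *: M) = Num.conj a *: sandwich L M.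
Proof. by apply/lfunP => X; rewrite superopZ !sandwichE adjmxZ -!scalemxAr. Qed.

(** With p, q, r, t for xx', xy', yx', yy', this is (x + y)(x' + y') + (x - y)(x' - y') for any
    biadditive product; it serves both [sandwich] and [tens_op]. *)
Lemma polarD (V : zmodType) (p q r t : V) :
  p + q + (r + t) + (p - q - (r - t)) = (p + t) *+ 2.
Proof.
rewrite opprB addrACA [p + q + _]addrACA subrr addr0 [r + t]addrC.
by rewrite [t + r + _]addrACA subrr addr0 mulr2n addrACA.
Qed.

Lemma polarB (V : zmodType) (p q r t : V) :
  p + q + (r + t) - (p - q - (r - t)) = (q + r) *+ 2.
Proof.
rewrite -(polarD q p t r) (addrC q p) (addrC t r); congr (_ + _).
by rewrite !opprB addrC.
Qed.

(** The Hermiticity-preserving part of [sandwich L M], whose conjugate is [sandwich M L]. *)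
Definition cross n (L M : 'M[C]_n) : superop R n n :=
  2^-1 *: (sandwich L M + sandwich M L).

Lemma conj_half : Num.conj 2^-1 = 2^-1 :> C.
Proof. by rewrite fmorphV rmorph_nat. Qed.

Lemma sandwich_half n (K : 'M[C]_n) :
  sandwich (2^-1 *: K) (2^-1 *: K) = (2^-1 * 2^-1) *: sandwich K K.
Proof. by rewrite sandwichZl sandwichZr scalerA conj_half. Qed.

Lemma sandwich_addsq n (L M : 'M[C]_n) : sandwich (L + M) (L + M) =
  sandwich L L + sandwich L M + (sandwich M L + sandwich M M).
Proof. by rewrite sandwichDl 2!sandwichDr. Qed.

Lemma sandwich_subsq n (L M : 'M[C]_n) : sandwich (L - M) (L - M) =
  sandwich L L - sandwich L M - (sandwich M L - sandwich M M).
Proof. by rewrite sandwich_addsq 2!sandwichNl 2!sandwichNr opprK opprB [- _ + _]addrC. Qed.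

Lemma scale_half_double (V : lmodType C) (v : V) : 2^-1 *: (v + v) = v.
Proof. by rewrite -mulr2n -(scaler_nat 2 v) scalerA mulVf ?pnatr_eq0 // scale1r. Qed.

(** Brings the terms of an expansion into the symmetric shape on the right of [cross_tens]. *)
Lemma sum_symmetrize (V : lmodType C) (I : finType) (a : I -> I -> C) (T : I -> I -> V) :
  (forall k l, a k l = a l k) ->
  \sum_k \sum_l a k l *: T k l = \sum_k \sum_l a k l *: (2^-1 *: (T k l + T l k)).
Proof.
move=> a_sym; set S := LHS.
have ES : \sum_k \sum_l a k l *: T l k = S.
  by rewrite exchange_big; apply: eq_bigr => k _; apply: eq_bigr => l _; rewrite a_sym.
rewrite -[S]scale_half_double -{2}ES -big_split scaler_sumr; apply: eq_bigr => k _.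
rewrite -big_split scaler_sumr; apply: eq_bigr => l _.
by rewrite /= -scalerDr !scalerA mulrC.
Qed.

Lemma scale_half_mul2n (V : lmodType C) (v : V) : (2^-1 * 2^-1) *: (v *+ 2) = 2^-1 *: v.
Proof. by rewrite -(scaler_nat 2 v) scalerA -mulrA mulVf ?pnatr_eq0 // mulr1. Qed.

Lemma tp_sandwich n (K : 'M[C]_n) : K \is unitarymx -> trace_preserving (sandwich K K).
Proof. by move=> /mul_adjmxV uK X; rewrite sandwichE mxtrace_mulC mulmxA uK mul1mx. Qed.

(** The two parts are conjugations by (L + M)/2 and (L - M)/2. Their difference is the cross term;
    their sum is the equal mixture of two unitary channels, so it preserves the trace. *)
Lemma cross_signed_local n (L M : 'M[C]_n) :
  L \is unitarymx -> M \is unitarymx -> signed_local (cross L M).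
Proof.
move=> uL uM; exists (sandwich (2^-1 *: (L + M)) (2^-1 *: (L + M))),
  (sandwich (2^-1 *: (L - M)) (2^-1 *: (L - M))).
split; [exact: cp_sandwich|exact: cp_sandwich| |]; last first.
  by rewrite 2!sandwich_half sandwich_addsq sandwich_subsq -scalerBr polarB scale_half_mul2n.
split; first by apply: cpD; apply: cp_sandwich.
rewrite 2!sandwich_half sandwich_addsq sandwich_subsq -scalerDr polarD scale_half_mul2n.
move=> X; rewrite superopZ superopD mxtraceZ mxtraceD (tp_sandwich uL) (tp_sandwich uM).
by rewrite -mulr2n -(mulr_natl (\tr X)) mulrA mulVf ?pnatr_eq0 // mul1r.
Qed.

Lemma tens_op0l n m p q (G : superop R p q) : tens_op (0 : superop R n m) G = 0.
Proof. by rewrite -(scale0r (0 : superop R n m)) tens_opZl scale0r. Qed.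

(* With a = [cross L M] and b = [cross L ('i *: M)], [sandwich L M] is a + ib and
   [sandwich M L] is a - ib. *)
Lemma cross_tens n p (L M : 'M[C]_n) (L' M' : 'M[C]_p) :
  tens_op (cross L M) (cross L' M') - tens_op (cross L ('i *: M)) (cross L' ('i *: M')) =
  2^-1 *: (sandwich (L *t L') (M *t M') + sandwich (M *t M') (L *t L')).
Proof.
have crossi m (K Q : 'M[C]_m) : cross K ('i *: Q) = (2^-1 * - 'i) *: (sandwich K Q - sandwich Q K).
  by rewrite /cross sandwichZr sandwichZl conjCi -scalerA scalerBr !scaleNr opprK.
rewrite 2!crossi /cross 2!tens_opZl 2!tens_opZr 2!scalerA.
have -> : 2^-1 * - 'i * (2^-1 * - 'i) = - (2^-1 * 2^-1) :> C.
  by rewrite mulrACA mulrNN -[X in _ * X]expr2 sqrCi mulrN1.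
rewrite scaleNr opprK -scalerDr 2!tens_opDl tens_opNl 4!tens_opDr 2!tens_opNr.
rewrite polarD scale_half_mul2n.
by rewrite !sandwich_tens.
Qed.

Section UpperBound.
Variables (d N : nat) (L M : 'I_N -> 'M[C]_d) (c : 'I_N -> R).
Hypothesis uL : forall k, L k \is unitarymx.
Hypothesis uM : forall k, M k \is unitarymx.
Hypothesis c_ge0 : forall k, 0 <= c k.
Hypothesis c_norm : \sum_k c k ^+ 2 = 1.

Let LO_term k l : LO d d (tens_op (cross (L k) (L l)) (cross (M k) (M l))).
Proof.
by exists (cross (L k) (L l)), (cross (M k) (M l)); split=> //; apply: cross_signed_local.
Qed.

Let LO_term_i k l :
  LO d d (tens_op (cross (L k) ('i *: L l)) (cross (M k) ('i *: M l))).
Proof.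
exists (cross (L k) ('i *: L l)), (cross (M k) ('i *: M l)); split=> //.
  by apply: cross_signed_local => //; rewrite scale_unitarymx ?normCi.
by apply: cross_signed_local => //; rewrite scale_unitarymx ?normCi.
Qed.

Let U : 'M[C]_(d * d) := \sum_k (c k)%:C *: (L k *t M k).

(** The flag [true] marks the terms with ['i]. On the diagonal these vanish by [cross_i_self], so
    their coefficient is set to 0 there; this saving is the -1 in the cost. *)
Let coef (p : 'I_N * 'I_N * bool) : R :=
  if p.2 then - (if p.1.1 == p.1.2 then 0 else c p.1.1 * c p.1.2) else c p.1.1 * c p.1.2.

Let term (p : 'I_N * 'I_N * bool) : superop R (d * d) (d * d) :=
  if p.2 then tens_op (cross (L p.1.1) ('i *: L p.1.2)) (cross (M p.1.1) ('i *: M p.1.2))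
  else tens_op (cross (L p.1.1) (L p.1.2)) (cross (M p.1.1) (M p.1.2)).

Let sum_triple (V : nmodType) (f : 'I_N * 'I_N * bool -> V) :
  \sum_p f p = \sum_k \sum_l (f (k, l, false) + f (k, l, true)).
Proof.
rewrite pair_bigA /= (eq_bigr (fun p => \sum_b f (p, b))).
  by rewrite pair_bigA; apply: eq_bigr => -[].
by move=> [k l] _; rewrite big_bool addrC.
Qed.

Let cross_i_self n (K : 'M[C]_n) : cross K ('i *: K) = 0.
Proof. by rewrite /cross sandwichZr sandwichZl conjCi scaleNr addNr scaler0. Qed.

Lemma unitary_channel_cross :
  unitary_channel U = \sum_p (coef p)%:C *: term p.
Proof.
pose T k l := sandwich (L k *t M k) (L l *t M l).
rewrite sum_triple.
transitivity (\sum_k \sum_l (c k * c l)%:C *: T k l).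
  rewrite -[unitary_channel U]/(sandwich U U) {1}/U sandwich_suml; apply: eq_bigr => k _.
  rewrite sandwich_sumr scaler_sumr; apply: eq_bigr => l _.
  by rewrite scalerA rmorphM; congr (_ * _ *: _); exact: conjc_real.
transitivity (\sum_k \sum_l (c k * c l)%:C *: (2^-1 *: (T k l + T l k))).
  by apply: sum_symmetrize => k l; rewrite mulrC.
apply: eq_bigr => k _; apply: eq_bigr => l _.
rewrite -cross_tens scalerBr; congr (_ + _).
rewrite /coef /term /= rmorphN scaleNr; congr (- _).
by case: eqP => [->|//]; rewrite cross_i_self tens_op0l !scaler0.
Qed.

(** The terms without ['i] cost (sum_k c_k)^2; those with it cost the same less the diagonal sum_k
    c_k^2 = 1. *)
Lemma sum_coef : \sum_p `|coef p| = 2 * (\sum_k c k) ^+ 2 - 1.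
Proof.
rewrite sum_triple.
have -> : 2 * (\sum_k c k) ^+ 2 - 1 =
    \sum_k \sum_l (c k * c l + (c k * c l - (if k == l then c k * c l else 0))).
  have sq : (\sum_k c k) ^+ 2 = \sum_k \sum_l c k * c l.
    by rewrite expr2 mulr_suml; apply: eq_bigr => k _; rewrite mulr_sumr.
  under [RHS]eq_bigr => k _ do rewrite big_split sumrB.
  rewrite big_split sumrB -sq mulr_natl mulr2n -addrA; congr (_ + (_ - _)).
  rewrite -c_norm; apply: eq_bigr => k _.
  by rewrite -big_mkcond (big_pred1 k) ?expr2 // => l; rewrite eq_sym.
apply: eq_bigr => k _; apply: eq_bigr => l _; rewrite /coef /= normrN.
have c0 : 0 <= c k * c l by rewrite mulr_ge0.
by case: ifP => _; rewrite (ger0_norm c0) ?normr0 ?subrr ?subr0.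
Qed.

Lemma LO_cost :
  decomposition_costs (@LO R d d) (unitary_channel U) (2 * (\sum_k c k) ^+ 2 - 1).
Proof.
rewrite unitary_channel_cross -sum_coef; apply: decomposition_cost_fin.
  (* A decomposition needs at least one term: an empty index set would make the sum of squares 0
     instead of 1. *)
  case: (posnP #|{: 'I_N * 'I_N * bool}|) => // N0.
  move: c_norm; rewrite big1 => [/eqP|k _]; first by rewrite eq_sym oner_eq0.
  by have := max_card (pred1 (k, k, true)); rewrite N0 card1.
by move=> [[k l] []]; rewrite /term; [apply: LO_term_i|apply: LO_term].
Qed.

End UpperBound.

End LocalDecomposition.

(** * Schmidt decompositions into unitaries: tensor powers and KAK forms *)

Section OperatorSchmidt.
Variable R : realType.
Local Notation C := R[i].

(* The phases of the Schmidt coefficients are absorbed in the unitaries [L k]. *)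
Definition unitary_schmidt d (U : 'M[C]_(d * d)) (s : R) : Prop :=
  exists N (L M : 'I_N -> 'M[C]_d) (c : 'I_N -> R),
    [/\ forall k, L k \is unitarymx /\ M k \is unitarymx,
        forall k l, \tr (adjmx (L k) *m L l) = d%:R * (k == l)%:R /\
                    \tr (adjmx (M k) *m M l) = d%:R * (k == l)%:R,
        forall k, 0 <= c k,
        \sum_k c k ^+ 2 = 1 /\ \sum_k c k = s
      & U = \sum_k (c k)%:C *: (L k *t M k)].

(** [S] lies between [LO] and [signed_separable]: the decomposition comes from the smaller set and
    the lower bound from the larger. *)
Lemma is_gamma_unitary_schmidt d (U : 'M[C]_(d * d)) s
    (S : forall a b : nat, set (superop R (a * b) (a * b))) :
  (0 < d)%N -> S = @LO R \/ S = @LOCC R -> unitary_schmidt U s ->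
  is_gamma (S d d) (unitary_channel U) (2 * s ^+ 2 - 1).
Proof.
move=> d0 hS [N [L [M [c [uLM oLM c0 [cn <-] ->]]]]].
have SLO : LO d d `<=` S d d by case: hS => -> //; apply: LO_LOCC.
have SSEP : S d d `<=` @signed_separable R d d.
  case: hS => ->; last exact: LOCC_separable.
  by apply: subset_trans (@LOCC_separable R d d); apply: LO_LOCC.
split.
  have [m [x [F [m0 LF EU cE]]]] := LO_cost (fun k => (uLM k).1) (fun k => (uLM k).2) c0 cn.
  by exists m, x, F; split=> // i; apply/SLO/LF.
move=> y [m [x [F [m0 SF EU ->]]]].
apply: (cost_lower_bound d0 (fun k l => (oLM k l).1) (fun k l => (oLM k l).2) cn).
by exists m, x, F; split=> // i; apply/SSEP/SF.
Qed.

Lemma bitens_sum a1 b1 a2 b2 (I J : finType) (x : I -> C) (y : J -> C)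
    (X : I -> 'M[C]_(a1 * b1)) (Y : J -> 'M[C]_(a2 * b2)) :
  bitens (\sum_i x i *: X i) (\sum_j y j *: Y j) =
  \sum_i \sum_j (x i * y j) *: bitens (X i) (Y j).
Proof.
apply/matrixP => r s; rewrite mxE; cbv zeta; rewrite !summxE mulr_suml.
apply: eq_bigr => i _; rewrite mulr_sumr summxE; apply: eq_bigr => j _.
by rewrite !mxE mulrACA.
Qed.

Lemma sum_mxtens_mul (K : comPzRingType) m n (f : 'I_m -> K) (g : 'I_n -> K) :
  \sum_(r : 'I_(m * n)) f (mxtens_unindex r).1 * g (mxtens_unindex r).2 =
  (\sum_i f i) * (\sum_j g j).
Proof.
rewrite big_mxtens_index mulr_suml; apply: eq_bigr => i _.
by rewrite mulr_sumr; apply: eq_bigr => j _; rewrite mxtens_indexK.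
Qed.

(** Terms are indexed by pairs, and every condition is multiplicative under Kronecker products;
    [bitens] regroups the four factors by party. *)
Lemma unitary_schmidt_bitens d e (U : 'M[C]_(d * d)) (V : 'M[C]_(e * e)) s t :
  unitary_schmidt U s -> unitary_schmidt V t -> unitary_schmidt (bitens U V) (s * t).
Proof.
move=> [N [L [M [c [uLM oLM c0 [cn <-] ->]]]]] [N' [L' [M' [c' [uLM' oLM' c0' [cn' <-] ->]]]]].
exists (N * N')%N, (fun r => L (mxtens_unindex r).1 *t L' (mxtens_unindex r).2),
  (fun r => M (mxtens_unindex r).1 *t M' (mxtens_unindex r).2),
  (fun r => c (mxtens_unindex r).1 * c' (mxtens_unindex r).2); split.
- by move=> k; split; apply: tens_unitarymx; rewrite ?(uLM _).1 ?(uLM' _).1 ?(uLM _).2 ?(uLM' _).2.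
- move=> p q; case: (mxtens_indexP p) => k k'; case: (mxtens_indexP q) => l l'.
  rewrite !mxtens_indexK !adjmx_tens !tensmx_mul !mxtrace_tens /=.
  rewrite (oLM k l).1 (oLM k l).2 (oLM' k' l').1 (oLM' k' l').2.
  rewrite (can_eq (@mxtens_indexK _ _)) xpair_eqE -mulnb 2!natrM.
  by split; rewrite mulrACA.
- by move=> r; rewrite mulr_ge0.
- split; last exact: sum_mxtens_mul.
  rewrite -[RHS]mulr1 -{1}cn -cn' -sum_mxtens_mul; apply: eq_bigr => r _.
  by rewrite exprMn.
rewrite bitens_sum big_mxtens_index; apply: eq_bigr => k _; apply: eq_bigr => l _.
by rewrite mxtens_indexK /= rmorphM bitens_tens.
Qed.

Lemma unitary_schmidt1 : unitary_schmidt (1%:M : 'M[C]_(1 * 1)) 1.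
Proof.
exists 1%N, (fun=> 1%:M), (fun=> 1%:M), (fun=> 1); split=> //.
- have u1 : (1%:M : 'M[C]_1) \is unitarymx by apply/unitarymxP; rewrite adjmx1 mul1mx.
  by move=> _.
- by move=> k l; rewrite adjmx1 mul1mx mxtrace1 !ord1 eqxx mulr1.
- by rewrite !big_ord1 expr1n.
by rewrite big_ord1 tensmx11 rmorph1 scale1r.
Qed.

Lemma unitary_schmidt_tens_power (U : 'M[C]_(2 * 2)) s n :
  unitary_schmidt U s -> unitary_schmidt (tens_power U n) (s ^+ n).
Proof.
move=> hU; elim: n => [|n IH] /=; first by rewrite expr0; apply: unitary_schmidt1.
by rewrite exprS; apply: unitary_schmidt_bitens.
Qed.

Lemma adjmx_mx22 (x y z t : C) :
  adjmx (mx22 x y z t) = mx22 (Num.conj x) (Num.conj z) (Num.conj y) (Num.conj t).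
Proof. by apply/matrixP => i j; rewrite !mxE; case: ifP; case: ifP. Qed.

Lemma mul_mx22 (x y z t x' y' z' t' : C) : mx22 x y z t *m mx22 x' y' z' t' =
  mx22 (x * x' + y * z') (x * y' + y * t') (z * x' + t * z') (z * y' + t * t').
Proof.
apply/matrixP => i j; rewrite !mxE !big_ord_recl big_ord0 addr0 !mxE /=.
by case: ifP; case: ifP.
Qed.

(** Puts the identity into entry form, so that all Pauli cases compute alike. *)
Lemma mx22_1 : mx22 1 0 0 1 = 1%:M :> 'M[C]_2.
Proof. by apply/matrixP => -[[|[|//]] hi] [[|[|//]] hj]; rewrite !mxE. Qed.

Lemma tr_mx22 (x y z t : C) : \tr (mx22 x y z t) = x + t.
Proof. by rewrite /mxtrace !big_ord_recl big_ord0 addr0 !mxE. Qed.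

Lemma conj_imaginary : Num.conj ('i%C : C) = - 'i%C.
Proof. by apply/eqP; rewrite eq_complex /= oppr0 !eqxx. Qed.

Lemma adjmx_pauli k : adjmx (pauli R k) = pauli R k.
Proof.
case: k => -[|[|[|[|//]]]] hk; rewrite /pauli /= -?mx22_1 adjmx_mx22.
- by rewrite !rmorph0 !rmorph1.
- by rewrite !rmorph0 !rmorph1.
- by rewrite rmorphN /= !conj_imaginary opprK !rmorph0.
- by rewrite !rmorph0 rmorphN1 !rmorph1.
Qed.

Lemma pauli_unitary k : pauli R k \is unitarymx.
Proof.
apply/unitarymxP; rewrite adjmx_pauli.
have ii : 'i%C * 'i%C = -1 :> C by rewrite -expr2 sqr_i.
case: k => -[|[|[|[|//]]]] hk; rewrite /pauli /= -?mx22_1 mul_mx22;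
  rewrite ?mulrNN ?mulNr ?mulrN ?ii ?opprK
    !(mul0r, mulr0, mul1r, mulr1, addr0, add0r, oppr0, opprK) //.
Qed.

Lemma pauli_orthogonal k l : \tr (adjmx (pauli R k) *m pauli R l) = 2 * (k == l)%:R.
Proof.
rewrite adjmx_pauli.
have ii : 'i%C * 'i%C = -1 :> C by rewrite -expr2 sqr_i.
case: k => -[|[|[|[|//]]]] hk; case: l => -[|[|[|[|//]]]] hl;
  rewrite /pauli /= -?mx22_1 mul_mx22 tr_mx22;
  rewrite ?mulrNN ?mulNr ?mulrN ?ii ?opprK
    !(mul0r, mulr0, mul1r, mulr1, addr0, add0r, oppr0, opprK, subrr, addNr) //.
Qed.

Lemma cmod_ge0 (z : C) : 0 <= cmod z.
Proof. by rewrite -lecR cmodE; apply: normr_ge0. Qed.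

Lemma phase_factor (z : C) : exists w : C, `|w| = 1 /\ z = (cmod z)%:C * w.
Proof.
have [->|z0] := eqVneq z 0.
  (* At z = 0 any number of modulus 1 serves as the phase. *)
  exists 1; rewrite normr1 mulr1; split=> //.
  by rewrite /cmod ComplexField.Normc.normc0.
exists (z / `|z|); rewrite cmodE normrM normfV normr_id divff ?normr_eq0 //.
by split=> //; rewrite mulrCA divff ?mulr1 // normr_eq0.
Qed.

Lemma unitary_schmidt_local d N (P : 'I_N -> 'M[C]_d) (u : 'I_N -> C) (V1 V2 V3 V4 : 'M[C]_d) :
  V1 \is unitarymx -> V2 \is unitarymx -> V3 \is unitarymx -> V4 \is unitarymx ->
  (forall k, P k \is unitarymx) ->
  (forall k l, \tr (adjmx (P k) *m P l) = d%:R * (k == l)%:R) ->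
  \sum_k cmod (u k) ^+ 2 = 1 ->
  unitary_schmidt ((V1 *t V2) *m (\sum_k u k *: (P k *t P k)) *m (V3 *t V4))
    (\sum_k cmod (u k)).
Proof.
move=> u1 u2 u3 u4 uP oP un; have [w hw] := choice (fun k => phase_factor (u k)).
have wn k : Num.conj (w k) * w k = 1.
  by rewrite mulrC -normCK (hw k).1 expr1n.
exists N, (fun k => w k *: (V1 *m P k *m V3)), (fun k => V2 *m P k *m V4), (fun k => cmod (u k)).
split.
- move=> k; split; last exact: mul_unitarymx (mul_unitarymx u2 (uP k)) u4.
  exact: scale_unitarymx (hw k).1 (mul_unitarymx (mul_unitarymx u1 (uP k)) u3).
- move=> k l; split; last by rewrite (mxtrace_adj_unitary _ _ u2 u4) oP.
  rewrite adjmxZ -scalemxAl -scalemxAr scalerA mxtraceZ (mxtrace_adj_unitary _ _ u1 u3) oP.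
  (* For equal indices the phases cancel; otherwise the trace is already 0. *)
  by case: eqP => [->|_]; rewrite ?mulr0 // wn mul1r.
- by move=> k; apply: cmod_ge0.
- by [].
rewrite mulmx_sumr mulmx_suml; apply: eq_bigr => k _.
rewrite tensmxZl scalerA -(hw k).2 -scalemxAr -scalemxAl.
by rewrite !tensmx_mul.
Qed.

Lemma unitary_schmidt_KAK (U : 'M[C]_(2 * 2)) u :
  KAK_parameters U u -> unitary_schmidt U (\sum_(i < 4) cmod (u i)).
Proof.
move=> [un [V1 [V2 [V3 [V4 [u1 u2 u3 u4 ->]]]]]].
exact: (unitary_schmidt_local u1 u2 u3 u4 pauli_unitary pauli_orthogonal un).
Qed.

End OperatorSchmidt.

(** * Limits of n-th roots *)

Section Limit.
Variable R : realType.

Lemma cvg_powR_inv (a : R) : 0 < a -> (fun n : nat => a `^ (n%:R)^-1) @ \oo --> (1 : R).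
Proof.
(* The shift skips n = 0 and makes the exponents the harmonic sequence 1/(n+1). *)
move=> a0; rewrite -cvg_shiftS /=.
have -> : (fun n : nat => a `^ (n.+1%:R)^-1) = (fun n => expR ((n.+1%:R)^-1 * ln a)).
  by apply/funext => n; rewrite /powR gt_eqF.
have cvg0 : (n.+1%:R)^-1 * ln a @[n --> \oo] --> (0 : R).
  by have := cvgM (@cvg_harmonic R) (cvg_cst (ln a)); rewrite mul0r; apply.
have := cvg_comp _ _ cvg0 (@continuous_expR R 0).
by rewrite expR0.
Qed.

(** Since s >= 1, the base lies between s^(2n) and 2 s^(2n), whose n-th roots are s^2 and 2^(1/n)
    s^2. *)
Lemma cvg_root_2expB1 (s : R) : 1 <= s ->
  (fun n : nat => (2 * s ^+ (2 * n) - 1) `^ (n%:R)^-1) @ \oo --> s ^+ 2.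
Proof.
move=> s1; have s0 : 0 <= s ^+ 2 by rewrite sqr_ge0.
have root (n : nat) : (0 < n)%N -> (s ^+ (2 * n)) `^ (n%:R)^-1 = s ^+ 2.
  move=> n0; rewrite exprM -powR_mulrn // -powRrM divff ?powRr1 //.
  by rewrite pnatr_eq0 -lt0n.
apply: (@squeeze_cvgr _ _ _ _ (fun=> s ^+ 2) (fun n : nat => 2 `^ (n%:R)^-1 * s ^+ 2)).
(* At n = 0 the exponent is 0^-1 = 0 and the root is 1, so the bounds are claimed only
   eventually. *)
- near=> n; have n0 : (0 < n)%N by near: n; exists 1%N.
  have p1 : 1 <= s ^+ (2 * n) by rewrite exprn_ege1.
  have p0 : 0 <= s ^+ (2 * n) by apply: le_trans p1.
  have q0 : s ^+ (2 * n) <= 2 * s ^+ (2 * n) - 1 by rewrite lerBrDr mulr_natl mulr2n lerD2l.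
  rewrite /= -(root n n0) -powRM //; apply/andP; split.
    by apply: ge0_ler_powR; rewrite ?nnegrE ?invr_ge0 //; apply: le_trans q0.
  apply: ge0_ler_powR; rewrite ?nnegrE ?invr_ge0 ?mulr_ge0 //; first exact: le_trans q0.
  by rewrite gerBl.
- exact: cvg_cst.
by have := cvgM (cvg_powR_inv (ltr0Sn R 1)) (cvg_cst (s ^+ 2)); rewrite mul1r; apply.
Unshelve. all: by end_near.
Qed.

End Limit.

(** * The regularized gamma-factor in terms of KAK parameters *)

Theorem corollary4p6 (R : realType) (U : 'M[R[i]]_(2 * 2)) (u : 'I_4 -> R[i])
  (hU : U \is unitarymx) (hu : KAK_parameters U u)
  (S : forall a b : nat, set (superop R (a * b) (a * b)))
  (hS : S = @LO R \/ S = @LOCC R) :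
  (exists gamma : nat -> R,
     (forall n : nat,
        is_gamma (S (qdim n) (qdim n)) (unitary_channel (tens_power U n)) (gamma n))
     /\ (fun n : nat => gamma n `^ (n%:R)^-1) @ \oo
          --> (\sum_(i < 4) cmod (u i)) ^+ 2)
  /\ (fun n : nat => (2 * (\sum_(i < 4) cmod (u i)) ^+ (2 * n) - 1) `^ (n%:R)^-1)
       @ \oo --> (\sum_(i < 4) cmod (u i)) ^+ 2
  /\ (\sum_(i < 4) cmod (u i)) ^+ 2
       = 1 + \sum_(i < 4) \sum_(j < 4 | i != j) cmod (u i) * cmod (u j).
Proof.
have us := unitary_schmidt_KAK hu; set s := \sum_(i < 4) cmod (u i) in us *.
have u0 k : 0 <= cmod (u k) by apply: cmod_ge0.
(* The diagonal of the expanded square sums to 1 by normalization of the parameters. *)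
have sE : s ^+ 2 = 1 + \sum_(i < 4) \sum_(j < 4 | i != j) cmod (u i) * cmod (u j).
  rewrite -hu.1 -big_split expr2 mulr_suml; apply: eq_bigr => i _.
  rewrite mulr_sumr (bigD1 i) //= expr2; congr (_ + _).
  by apply: eq_bigl => j; rewrite eq_sym.
have s1 : 1 <= s.
  rewrite -(@ler_pXn2r _ 2) ?nnegrE ?sumr_ge0 // expr1n sE lerDl.
  by apply: sumr_ge0 => i _; apply: sumr_ge0 => j _; rewrite mulr_ge0.
have lim := cvg_root_2expB1 s1.
split; last by split.
exists (fun n => 2 * s ^+ (2 * n) - 1); split=> // n.
(* The n-th tensor power has Schmidt sum s^n, so s^(2n) is rewritten as (s^n)^2. *)
rewrite mulnC exprM; apply: is_gamma_unitary_schmidt => //.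
  by rewrite qdimE expn_gt0.
exact: unitary_schmidt_tens_power.
Qed.
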